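(* (1) The countably infinite complete graph $K^{\aleph_0}$ is not strongly immersed in the Farey graph. (2) Neither $K^{\aleph_0}$ nor the Farey graph is strongly immersed in the halved Farey graph.
   Context: All graphs are simple. A strong immersion of $H$ in $G$ is a map $\alpha$ on $V(H)\sqcup E(H)$ that embeds $V(H)$ injectively into $V(G)$ and sends each edge $uv$ of $H$ to an $\alpha(u)$--$\alpha(v)$ path of $G$, the paths being pairwise edge-disjoint and having no internal vertices in $\alpha[V(H)]$. Halved Farey graph: $\breve F_0$ is a $K^2$ with its edge blue; $\breve F_{n+1}$ arises from $\breve F_n$ by adding for each blue edge $e$ a new vertex $v_e$ joined by two blue edges to the ends of $e$, and recolouring the edges of $\breve F_n$ black; $\breve F=\bigcup_n\breve F_n$. The Farey graph is the union $G_1\cup G_2$ of two copies $G_1,G_2$ of the halved Farey graph with $G_1\cap G_2=\breve F_0$ (equivalently, the graph on $\mathbb Q\cup\{\infty\}$ in which $a/b$ and $c/d$ in lowest terms, with $\infty=(\pm1)/0$, are adjacent iff $ad-bc=\pm1$). *)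

(* Defs.v *)
From mathcomp Require Import all_boot.
From mathcomp Require Import boolp.
Set Implicit Arguments.
Unset Strict Implicit.
Unset Printing Implicit Defensive.

Record sgraph := SGraph {
  vertex :> eqType;
  adj : rel vertex;
  adj_sym : symmetric adj;
  adj_irrefl : irreflexive adj }.

(** A path is the list of all its vertices, both ends included. *)
Definition path_between (G : sgraph) (a b : G) (p : seq G) : bool :=
  if p is x :: q
  then [&& x == a, last x q == b, path (@adj G) x q & uniq p]
  else false.

Definition edge_of_path (G : sgraph) (x y : G) (p : seq G) : bool :=
  ((x, y) \in zip p (behead p)) || ((y, x) \in zip p (behead p)).

Definition same_edge (T : Type) (u v u' v' : T) : Prop :=
  (u = u' /\ v = v') \/ (u = v' /\ v = u').

(** An edge of [H] is presented by either of its two orientations, so [alphaE]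
    takes two vertices; its values off the edges of [H] are irrelevant, and
    [si_rev] says that it assigns a single undirected path to each edge. *)
Record strong_immersion (H G : sgraph)
    (alphaV : H -> G) (alphaE : H -> H -> seq G) : Prop := StrongImmersion {
  si_inj : injective alphaV;
  si_rev : forall u v, adj u v -> alphaE v u = rev (alphaE u v);
  si_path : forall u v, adj u v ->
    path_between (alphaV u) (alphaV v) (alphaE u v);
  si_edge_disjoint : forall u v u' v', adj u v -> adj u' v' ->
    ~ same_edge u v u' v' ->
    forall x y, ~~ (edge_of_path x y (alphaE u v) &&
                    edge_of_path x y (alphaE u' v'));
  si_internal : forall u v, adj u v -> forall x, x \in alphaE u v ->
    x != alphaV u -> x != alphaV v -> forall w, alphaV w != x }.

Definition strongly_immersed (H G : sgraph) : Prop :=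
  exists (alphaV : H -> G) (alphaE : H -> H -> seq G),
    strong_immersion alphaV alphaE.

Definition complete_adj : rel nat := fun m n => m != n.

Lemma complete_sym : symmetric complete_adj.
Proof. by move=> m n; rewrite /complete_adj eq_sym. Qed.

Lemma complete_irrefl : irreflexive complete_adj.
Proof. by move=> m; rewrite /complete_adj eqxx. Qed.

Definition K_aleph0 : sgraph := SGraph complete_sym complete_irrefl.

(** The blue edges of the [n]-th stage of the halved Farey graph are coded by
    the bit strings of length [n]: [[::]] is the edge of the initial [K^2], and
    [b :: e] is the edge joining the new vertex [v_e] to the end of [e] selected
    by [b].  A vertex is one of the two vertices [inl b] of the initial [K^2]
    or a vertex [v_e = inr e]. *)
Definition hvertex : Type := (bool + seq bool)%type.

Fixpoint blue_ends (e : seq bool) : hvertex * hvertex :=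
  match e with
  | [::] => (inl false, inl true)
  | b :: e' => (if b then (blue_ends e').2 else (blue_ends e').1, inr e')
  end.

Definition halved_blue (n : nat) (u v : hvertex) : Prop :=
  exists e : seq bool, size e = n /\
    (blue_ends e = (u, v) \/ blue_ends e = (v, u)).

Fixpoint halved_black (n : nat) (u v : hvertex) : Prop :=
  if n is m.+1 then halved_black m u v \/ halved_blue m u v else False.

Definition halved_stage_adj (n : nat) (u v : hvertex) : Prop :=
  halved_blue n u v \/ halved_black n u v.

(** No vertex needs to be discarded in the union of the stages: [inl b] is in
    every stage, and [inr e] in every stage after the [size e]-th. *)
Definition halved_adj : rel hvertex :=
  fun u v => `[< exists n, halved_stage_adj n u v >].

Lemma halved_adjP (u v : hvertex) :
  reflect (exists e, blue_ends e = (u, v) \/ blue_ends e = (v, u))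
          (halved_adj u v).
Proof.
apply: (iffP (asboolP _)) => [[n]|[e he]]; last first.
  by exists (size e); left; exists e.
rewrite /halved_stage_adj => -[[e [_ he]]|]; first by exists e.
by elim: n => [|n IHn] //= [/IHn|[e [_ he]]] //; exists e.
Qed.

Lemma halved_sym : symmetric halved_adj.
Proof.
by move=> u v; apply/halved_adjP/halved_adjP => -[e he]; exists e; tauto.
Qed.

Definition born (u : hvertex) : nat := if u is inr e then (size e).+1 else 0.

Lemma born_blue_ends (e : seq bool) :
  born (blue_ends e).1 <= size e /\ born (blue_ends e).2 <= size e.
Proof.
elim: e => [|b e [IH1 IH2]] //=; split=> //.
by case: b; apply: leqW.
Qed.

Lemma blue_ends_neq (e : seq bool) : (blue_ends e).1 <> (blue_ends e).2.
Proof.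
case: e => [|b e] //= h; have [] := born_blue_ends e.
by case: b h => -> /=; rewrite ltnn.
Qed.

Lemma blue_ends_inj : injective blue_ends.
Proof.
have ne := blue_ends_neq.
move=> [|b e] [|b' e'] //= [hb he]; subst e'.
by case: b b' hb => -[] // /esym; [move/esym=> h | move=> h]; case: (ne e).
Qed.

Lemma halved_irrefl : irreflexive halved_adj.
Proof.
move=> u; apply/negP => /halved_adjP[e he]; apply: (@blue_ends_neq e).
by case: he => ->.
Qed.

Definition halved_Farey : sgraph := SGraph halved_sym halved_irrefl.

(** Two copies, tagged by a bit, of the halved Farey graph that share exactly
    the vertices [inl b] and the edge between them. *)
Definition fvertex : Type := (bool + bool * seq bool)%type.

Definition copy (i : bool) (u : hvertex) : fvertex :=
  match u with inl b => inl b | inr e => inr (i, e) end.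

Definition Farey_adj : rel fvertex :=
  fun x y => `[< exists i u v, [/\ halved_adj u v, x = copy i u & y = copy i v] >].

Lemma copy_inj (i : bool) : injective (copy i).
Proof. by case=> [b|e] [b'|e'] //= [->]. Qed.

Lemma Farey_sym : symmetric Farey_adj.
Proof.
by move=> x y; apply/asboolP/asboolP => -[i [u [v [huv -> ->]]]];
  exists i, v, u; rewrite halved_sym.
Qed.

Lemma Farey_irrefl : irreflexive Farey_adj.
Proof.
move=> x; apply/negP => /asboolP[i [u [v [huv -> /copy_inj euv]]]].
by rewrite euv halved_irrefl in huv.
Qed.

Definition Farey : sgraph := SGraph Farey_sym Farey_irrefl.

(* Main.v *)
(** Place the halved Farey graph on [0, 1], each new vertex at the midpoint of
    the ends of its edge: only finitely many edges pass over a given vertex.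
    Deleting a vertex of the halved Farey graph, or two vertices of the Farey
    graph, therefore leaves a partition into two intervals (two arcs) with
    finitely many edges in between.  In a strong immersion the paths avoid all
    other branch vertices, so only finitely many edges of the immersed graph
    may cross such a cut at branch vertices.

    In [K_aleph0] every cut that remains after deleting finitely many vertices
    has infinitely many edges; three branch vertices on the interval, or four
    on the circle, give a contradiction.  In the Farey graph take a triangle
    and delete the vertex whose image is the middle one: the opposite edge
    crosses the cut, and above it lie infinitely many edges that do. *)
Require Import Defs.
From mathcomp Require Import all_boot.
From mathcomp Require Import boolp order ssralg ssrnum rat zify lra.
Set Implicit Arguments.
Unset Strict Implicit.
Unset Printing Implicit Defensive.
Import Order.TTheory GRing.Theory Num.Theory.

(** * Finite cuts and strong immersions *)

Lemma path_cut_edge (T : eqType) (R : rel T) (P : pred T) (x : T) (p : seq T) :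
  path R x p -> P x != P (last x p) ->
  exists a b, [/\ a \in x :: p, b \in x :: p, (a, b) \in zip (x :: p) p,
    R a b & P a != P b].
Proof.
elim: p x => [|y p IHp] x; first by rewrite eqxx.
rewrite [path _ _ _]/= [last _ _]/= => /andP[Rxy pathp] neqP.
have [eqP | neq] := eqVneq (P x) (P y); last first.
  by exists x, y; rewrite !inE !eqxx orbT.
have [|a [b [ap bp abp Rab Pab]]] := IHp y pathp; first by rewrite -eqP.
by exists a, b; rewrite inE ap inE bp inE abp !orbT.
Qed.

(* [X] is the set of deleted vertices. *)
Definition finite_cut (G : sgraph) (S X : pred G) : Prop :=
  exists L : seq (G * G), forall x y : G, adj x y ->
    ~~ X x -> ~~ X y -> S x != S y -> (x, y) \in L \/ (y, x) \in L.

(* Distinct edges of [H] that cross the cut have edge-disjoint paths, each of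
   which contains one of the finitely many edges of [G] across the cut. *)
Lemma immersion_finite_cut (H G : sgraph) (aV : H -> G) (aE : H -> H -> seq G)
    (S X : pred G) (D : nat -> H * H) :
    strong_immersion aV aE ->
    finite_cut S X ->
    (forall x, X x -> exists h, aV h = x) ->
    (forall n, adj (D n).1 (D n).2) ->
    (forall n, ~~ X (aV (D n).1) /\ ~~ X (aV (D n).2)) ->
    (forall n, S (aV (D n).1) != S (aV (D n).2)) ->
    (forall m n, same_edge (D m).1 (D m).2 (D n).1 (D n).2 -> m = n) ->
  False.
Proof.
move=> si [L cutL] Xim adjD offD crossD injD.
have /choice[f fP] n : exists l : G * G,
    l \in L /\ edge_of_path l.1 l.2 (aE (D n).1 (D n).2).
  move: (adjD n) (offD n) (crossD n).
  case: (D n) => u v /= auv [Xu Xv] Suv.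
  have offX x : x \in aE u v -> ~~ X x.
    move=> xp; apply/negP => Xx; have [h hx] := Xim x Xx.
    have [xu|xu] := eqVneq x (aV u); first by rewrite -xu Xx in Xu.
    have [xv|xv] := eqVneq x (aV v); first by rewrite -xv Xx in Xv.
    by have := si_internal si auv xp xu xv h; rewrite hx eqxx.
  move: (si_path si auv) offX; case: (aE u v) => [|x p] //=.
  case/and4P=> /eqP -> /eqP lastp pathp _ offX.
  have [|a [b [ap bp abp Rab Sab]]] := path_cut_edge (P := S) pathp.
    by rewrite lastp.
  have [abL | baL] := cutL a b Rab (offX a ap) (offX b bp) Sab.
    by exists (a, b); split=> //; rewrite /edge_of_path /= abp.
  by exists (b, a); split=> //; rewrite /edge_of_path /= abp orbT.
have finj : injective f.
  move=> m n fmn; apply: injD; apply: contrapT => nse.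
  have := si_edge_disjoint si (adjD m) (adjD n) nse (f m).1 (f m).2.
  by rewrite (fP m).2 fmn (fP n).2.
(* Pigeonhole: [f] would take more distinct values in [L] than [L] has entries. *)
pose s := [seq f i | i <- iota 0 (size L).+1].
have us : uniq s by rewrite map_inj_uniq ?iota_uniq.
have sL : {subset s <= L} by move=> l /mapP[i _ ->]; case: (fP i).
by have := uniq_leq_size us sL; rewrite size_map size_iota ltnn.
Qed.

(* Every further branch vertex sends an edge across the cut to [a] or to [b]. *)
Lemma complete_finite_cut (G : sgraph) (aV : K_aleph0 -> G) aE (S X : pred G)
    (N a b : nat) :
    strong_immersion aV aE ->
    finite_cut S X ->
    (forall x, X x -> exists h, aV h = x) ->
    (forall n, N <= n -> ~~ X (aV n)) ->
    ~~ X (aV a) -> ~~ X (aV b) -> S (aV a) = S (aV b).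
Proof.
move=> si cutS Xim offX Xa Xb; apply/eqP; apply: contrapT => /negP Sab.
(* The offset puts every [k n] past [N], [a] and [b]. *)
pose k n := N + (a + b).+1 + n.
pose D n : K_aleph0 * K_aleph0 :=
  if S (aV (k n)) == S (aV a) then (k n, b) else (a, k n).
have ka n : k n != a by apply/eqP; rewrite /k; lia.
have kb n : k n != b by apply/eqP; rewrite /k; lia.
have Xk n : ~~ X (aV (k n)) by apply: offX; rewrite /k; lia.
apply: (immersion_finite_cut (D := D) si cutS Xim) => [n|n|n|m n].
- by rewrite /D; case: ifP => _ /=; rewrite /complete_adj ?kb // eq_sym ka.
- by rewrite /D; case: ifP => _ /=; split=> //; apply: Xk.
- by rewrite /D; case: ifP => [/eqP -> //|] /=; rewrite eq_sym => ->.
have := (ka m, ka n, kb m, kb n); rewrite /D /same_edge /k.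
by case: ifP; case: ifP => /= _ _ [[[/eqP ? /eqP ?] /eqP ?] /eqP ?] ?; lia.
Qed.

(** * Positions in the unit interval and the finite cuts they give *)

Section Position.
Local Open Scope ring_scope.

Fixpoint ends_pos (e : seq bool) : rat * rat :=
  if e is b :: e' then
    let: (p, q) := ends_pos e' in (if b then q else p, (p + q) / 2)
  else (0, 1).

Definition pos (x : hvertex) : rat :=
  match x with
  | inl b => b%:R
  | inr e => ((ends_pos e).1 + (ends_pos e).2) / 2
  end.

(** Symmetric in [p] and [q], as [blue_ends] does not list the ends by increasing position. *)
Definition between (p q t : rat) : bool := (p < t < q) || (q < t < p).

Definition spans (e : seq bool) (x : hvertex) : bool :=
  between (pos (blue_ends e).1) (pos (blue_ends e).2) (pos x).

Lemma ends_posE e : ends_pos e = (pos (blue_ends e).1, pos (blue_ends e).2).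
Proof.
by elim: e => [|b e IHe] //=; rewrite IHe; case: b.
Qed.

Lemma pos_mid e :
  pos (inr e) = (pos (blue_ends e).1 + pos (blue_ends e).2) / 2.
Proof. by rewrite /= ends_posE. Qed.

Lemma pos_ends_neq e : pos (blue_ends e).1 != pos (blue_ends e).2.
Proof.
elim: e => [|b e IHe] //.
have := pos_mid e; move: IHe; rewrite [blue_ends (b :: e)]/=.
move: (pos (inr e)) => m; rewrite neq_lt.
by case: b => /=; move: (pos _) (pos _) => p q; rewrite neq_lt; lra.
Qed.

Lemma spans_mid e : spans e (inr e).
Proof.
rewrite /spans pos_mid /between; have := pos_ends_neq e.
move: (pos _) (pos _) => p q; rewrite neq_lt; lra.
Qed.

Lemma spans_cons b e x : spans (b :: e) x -> spans e x.
Proof.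
rewrite /spans; have := spans_mid e; rewrite /spans /between.
rewrite [blue_ends (b :: e)]/=.
move: (pos (inr e)) (pos x) => m t.
by case: b => /=; move: (pos _) (pos _) => p q; lra.
Qed.

Lemma spans_cat w e x : spans (w ++ e) x -> spans e x.
Proof. by elim: w => [|b w IHw] //= /spans_cons. Qed.

(** Each edge on top of [e] covers one half of it: a vertex over [b :: e] is over [e], and the bit
    of its code next to [e] must select the same half. *)
Lemma spansP e x : spans e x -> exists w, x = inr (w ++ e).
Proof.
elim: e => [|b e IHe] sx.
  case: x sx => [c|f] sx; last by exists f; rewrite cats0.
  by move: sx; rewrite /spans /between; case: c.
have [w xE] := IHe (spans_cons sx); subst x; clear IHe.
(* If [w] is empty, [x] is the new vertex of [e], an end of [b :: e]. Otherwise the last bit [c] of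
   [w] tells which half of [e] contains [x]. *)
case/lastP: w sx => [|w c] sx.
  exfalso; move: sx; rewrite /spans /between.
  rewrite [blue_ends (b :: e)]/= [[::] ++ _]/=.
  by case: b => /=; rewrite !ltxx !andbF.
rewrite cat_rcons in sx *.
have [-> | neq] := eqVneq c b; first by exists w.
have := spans_cat (spans_mid (w ++ c :: e)); have := spans_mid e.
move: sx neq; rewrite /spans /between ![blue_ends (_ :: e)]/=.
move: (pos (inr e)) (pos (inr (_ ++ _))) => m t.
by case: b c => -[] //=; move: (pos _) (pos _) => p q; lra.
Qed.

Lemma pos_inr_bounds f : 0 < pos (inr f) < 1.
Proof.
have /spans_cat : spans (f ++ [::]) (inr f) by rewrite cats0 spans_mid.
by rewrite /spans /between /=; lra.
Qed.

Lemma pos_bounds x : 0 <= pos x <= 1.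
Proof.
case: x => [b | f]; first by case: b => /=; lra.
by have := pos_inr_bounds f; lra.
Qed.

(** Two new vertices at the same position lie over each other's edges, so each code is a suffix of
    the other. *)
Lemma pos_inj : injective pos.
Proof.
move=> [b|e] [c|f] exf.
- by case: b c exf => -[].
- by have := pos_inr_bounds f; rewrite -exf; case: b {exf}.
- by have := pos_inr_bounds e; rewrite exf; case: c {exf}.
have [w1 E1] : exists w, inr f = inr (w ++ e) :> hvertex.
  by apply: spansP; have := spans_mid e; rewrite /spans exf.
have [w2 E2] : exists w, inr e = inr (w ++ f) :> hvertex.
  by apply: spansP; have := spans_mid f; rewrite /spans exf.
case: E1 => fE; case: E2 => eE.
move/(congr1 size): (eE); rewrite {1}fE !size_cat => szE.
have w20 : size w2 = 0%N.
  move/(congr1 size): (fE); rewrite eE !size_cat; lia.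
by rewrite eE (size0nil w20).
Qed.

Lemma between_trichotomy (x y z : hvertex) : x <> y -> y <> z -> x <> z ->
  [\/ between (pos y) (pos z) (pos x), between (pos x) (pos z) (pos y)
    | between (pos x) (pos y) (pos z)].
Proof.
move=> /(contra_not (@pos_inj x y))/eqP xy /(contra_not (@pos_inj y z))/eqP yz.
move=> /(contra_not (@pos_inj x z))/eqP xz.
move: xy yz xz; rewrite !neq_lt /between.
move: (pos x) (pos y) (pos z) => p q r.
case/orP=> pq; case/orP=> qr; case/orP=> pr;
  try (apply: Or31; lra); try (apply: Or32; lra); try (apply: Or33; lra).
Qed.

(** By [spansP], an edge over [inr f] is coded by a suffix of [f], and no edge passes over an
    initial vertex. *)
Lemma finitely_many_spanning (x : hvertex) :
  exists L : seq (hvertex * hvertex), forall p q, halved_adj p q ->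
    between (pos p) (pos q) (pos x) -> (p, q) \in L \/ (q, p) \in L.
Proof.
pose f := if x is inr f then f else [::].
pose L := [seq blue_ends (drop i f) | i <- iota 0 (size f).+1].
have spansL e : spans e x -> blue_ends e \in L.
  move=> /spansP[w xE]; apply/mapP; exists (size w).
    by rewrite mem_iota /f xE size_cat; lia.
  by rewrite /f xE drop_size_cat.
exists L => p q /halved_adjP[e eE] pqx.
have : blue_ends e \in L.
  apply: spansL; move: pqx; rewrite /spans /between.
  by case: eE => -> //=; rewrite orbC.
by case: eE => ->; [left | right].
Qed.

Lemma halved_finite_cut (x : halved_Farey) :
  finite_cut (fun y : halved_Farey => pos y < pos x) (pred1 x).
Proof.
have [L LP] := finitely_many_spanning x; exists L => p q pq px qx Spq.
apply: LP => //; move: px qx Spq => /=.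
rewrite -!(inj_eq pos_inj) /between.
by case: (ltgtP (pos p) (pos x)); case: (ltgtP (pos q) (pos x)) => //=; lra.
Qed.

(** An open arc of the circle formed by the two copies. Initial vertices, at 0 and 1, are never
    strictly between positions of vertices. *)
Definition inside (i : bool) (p q : rat) (x : Farey) : bool :=
  if x is inr (j, e) then (j == i) && between p q (pos (inr e)) else false.

Lemma inside_copy i u v w :
  inside i (pos u) (pos v) (copy i w) = between (pos u) (pos v) (pos w).
Proof.
case: w => [b|e] /=; last by rewrite eqxx.
have := pos_bounds u; have := pos_bounds v; rewrite /between.
by case: b => /=; lra.
Qed.

(** An edge of copy [i] that crosses the cut passes over [u] or [v]; edges of the other copy stay
    outside the arc. *)
Lemma Farey_finite_cut i u v :
  finite_cut (inside i (pos u) (pos v)) (pred2 (copy i u) (copy i v)).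
Proof.
have [Lu LuP] := finitely_many_spanning u.
have [Lv LvP] := finitely_many_spanning v.
pose L := [seq (copy i l.1, copy i l.2) | l <- Lu ++ Lv].
exists L => x y /asboolP[j [p [q [pq -> ->]]]] {x y}.
have [-> | neq] := eqVneq j i; last first.
  have out w : inside i (pos u) (pos v) (copy j w) = false.
    by case: w => [b|e] //=; rewrite (negPf neq).
  by rewrite !out.
rewrite /= !(inj_eq (@copy_inj i)) !negb_or !inside_copy -!(inj_eq pos_inj).
move=> /andP[pu pv] /andP[qu qv] Spq.
have Lmem a b : (a, b) \in Lu ++ Lv -> (copy i a, copy i b) \in L.
  exact: (map_f (fun l => (copy i l.1, copy i l.2))).
have : between (pos p) (pos q) (pos u) \/ between (pos p) (pos q) (pos v).
  apply/orP; move: pu pv qu qv Spq; rewrite /between.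
  by case: (ltgtP (pos p) (pos u)); case: (ltgtP (pos p) (pos v));
    case: (ltgtP (pos q) (pos u)); case: (ltgtP (pos q) (pos v)).
case=> [/(LuP p q pq) | /(LvP p q pq)] [pqL | qpL];
  by [left; apply: Lmem; rewrite mem_cat pqL ?orbT
     |right; apply: Lmem; rewrite mem_cat qpL ?orbT].
Qed.

End Position.

(** * Immersions of the complete graph *)

Lemma complete_not_in_halved : ~ strongly_immersed K_aleph0 halved_Farey.
Proof.
case=> aV [aE si].
have not_mid a b u : a <> u -> b <> u ->
    ~ between (pos (aV a)) (pos (aV b)) (pos (aV u)).
  move=> au bu abu.
  have : (pos (aV a) < pos (aV u))%R = (pos (aV b) < pos (aV u))%R.
    (* Only the image of [u] is deleted, so all later branch vertices survive. *)
    apply: (complete_finite_cut (N := u.+1) si (halved_finite_cut (aV u))).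
    - by move=> x /eqP ->; exists u.
    - by move=> n un; rewrite /= (inj_eq (si_inj si)); apply/eqP; lia.
    - by rewrite /= (inj_eq (si_inj si)); apply/eqP.
    - by rewrite /= (inj_eq (si_inj si)); apply/eqP.
  move: abu; rewrite /between.
  by case: (ltgtP (pos (aV a))); case: (ltgtP (pos (aV b))).
have inj : injective aV := si_inj si.
by case: (@between_trichotomy (aV 0) (aV 1) (aV 2));
  do ?[by move/inj]; apply: not_mid.
Qed.

(* If four branch vertices alternate around the circle, the first and the third
   span a finite cut separating the other two. *)
Lemma complete_no_crossing (aV : K_aleph0 -> Farey) aE i u v (a b s t : nat) :
    strong_immersion aV aE ->
    aV a = copy i u -> aV b = copy i v ->
    s <> a -> s <> b -> t <> a -> t <> b ->
  inside i (pos u) (pos v) (aV s) = inside i (pos u) (pos v) (aV t).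
Proof.
move=> si ua vb sa sb ta tb.
have off n : n <> a -> n <> b -> ~~ pred2 (copy i u) (copy i v) (aV n).
  move=> na nb; rewrite /= -ua -vb !(inj_eq (si_inj si)) negb_or.
  by apply/andP; split; apply/eqP.
apply: (complete_finite_cut (N := (a + b).+1) si (Farey_finite_cut i u v)).
- by move=> x /orP[] /eqP ->; [exists a | exists b].
- by move=> n abn; apply: off; lia.
- exact: off.
- exact: off.
Qed.

(** Cutting at [u] and [w] puts [d] on the side of [v], hence in copy [i] between [u] and [w].
    Cutting at [v], [w] and at [u], [v] keeps [d] out of both subarcs, which leaves only [v]
    itself. *)
Lemma complete_no_four (aV : K_aleph0 -> Farey) aE i u v w (a b c d : nat) :
    strong_immersion aV aE ->
    aV a = copy i u -> aV b = copy i v -> aV c = copy i w ->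
    uniq [:: a; b; c; d] -> ~ between (pos u) (pos w) (pos v).
Proof.
move=> si ua vb wc /= uniq_abcd uvw.
have [[ab ac ad] [bc bd] cd] :
    [/\ [/\ a <> b, a <> c & a <> d], b <> c /\ b <> d & c <> d].
  by move: uniq_abcd; rewrite !inE; split; [split|split|]; lia.
have dE : inside i (pos u) (pos w) (aV d).
  rewrite -(complete_no_crossing (s := b) si ua wc) ?vb ?inside_copy //;
    exact: nesym.
have [x dx] : exists x, aV d = copy i x.
  by move: dE; case: (aV d) => // -[j e] /andP[/eqP -> _]; exists (inr e).
rewrite dx inside_copy in dE.
have neq : v <> x by move=> vx; apply: bd; apply: (si_inj si); rewrite vb dx vx.
have H1 : between (pos v) (pos w) (pos x) = between (pos v) (pos w) (pos u).
  rewrite -!(inside_copy i) -dx -ua.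
  by apply: (complete_no_crossing si vb wc) => //; exact: nesym.
have H2 : between (pos u) (pos v) (pos x) = between (pos u) (pos v) (pos w).
  rewrite -!(inside_copy i) -dx -wc.
  by apply: (complete_no_crossing si ua vb) => //; exact: nesym.
have {}neq : pos v != pos x by apply/eqP => /pos_inj.
move: H1 H2 uvw dE neq; rewrite /between neq_lt.
move: (pos u) (pos v) (pos w) (pos x) => p q r t.
by case: (ltgtP p q); case: (ltgtP q r); case: (ltgtP p r); case: (ltgtP q t);
  case: (ltgtP p t); case: (ltgtP r t) => //=; lra.
Qed.

Lemma complete_not_in_Farey : ~ strongly_immersed K_aleph0 Farey.
Proof.
case=> aV [aE si].
have inj : injective aV := si_inj si.
have no3 i u v w (a b c : nat) d : uniq [:: a; b; c; d] ->
    aV a = copy i u -> aV b = copy i v -> aV c = copy i w -> False.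
  move=> abcd ua vb wc.
  have [ab bc ac] : [/\ u <> v, v <> w & u <> w].
    move: abcd; rewrite /= !inE => abcd.
    have abc : [/\ a <> b, b <> c & a <> c] by split; lia.
    by case: abc => ab bc ac; split=> e; [apply: ab|apply: bc|apply: ac];
      apply: inj; rewrite ?ua ?vb ?wc e.
  case: (between_trichotomy ab bc ac).
  - apply: (complete_no_four (a := b) (b := a) (c := c) (d := d) si vb ua wc).
    by move: abcd; rewrite /= !inE; lia.
  - exact: (complete_no_four si ua vb wc abcd).
  - apply: (complete_no_four (a := a) (b := c) (c := b) (d := d) si ua wc vb).
    by move: abcd; rewrite /= !inE; lia.
(* Initial vertices lie in both copies; the tag [true] is an arbitrary choice. *)
have /choice[i /choice[h iP]] n : exists i h, aV n = copy i h.
  by case: (aV n) => [b|[i e]]; [exists true, (inl b) | exists i, (inr e)].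
(* Three of the branch vertices 0 to 4 lie in one copy; 5 is the spare fourth. *)
have same a b c : uniq [:: a; b; c; 5] -> i a = i b -> i a = i c -> False.
  move=> abc iab iac; apply: (no3 (i a) (h a) (h b) (h c) a b c 5 abc).
  - exact: iP.
  - by rewrite iab.
  - by rewrite iac.
move: (same 0 1 2 isT) (same 0 1 3 isT) (same 0 1 4 isT) (same 0 2 3 isT)
  (same 0 2 4 isT) (same 0 3 4 isT) (same 1 2 3 isT) (same 1 2 4 isT)
  (same 1 3 4 isT) (same 2 3 4 isT).
by case: (i 0) (i 1) (i 2) (i 3) (i 4) => [] [] [] [] []; auto.
Qed.

(** * Immersions of the Farey graph *)

(** The later-born end dates a blue edge, so edges of different stages are distinct. *)
Lemma born_blue_ends_max e :
  maxn (born (blue_ends e).1) (born (blue_ends e).2) = size e.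
Proof.
case: e => [|b e] //=; have [] := born_blue_ends e.
by case: b => /=; lia.
Qed.

Lemma Farey_blue i e :
  Farey_adj (copy i (blue_ends e).1) (copy i (blue_ends e).2).
Proof.
apply/asboolP; exists i, (blue_ends e).1, (blue_ends e).2; split=> //.
by apply/halved_adjP; exists e; left; case: (blue_ends e).
Qed.

(* A blue edge across the cut passes this property on to one of the two blue
   edges on top of it, hence to one edge of every later stage. *)
Lemma Farey_finite_cut_ends (G : sgraph) (aV : Farey -> G) aE (S X : pred G)
    i e :
    strong_immersion aV aE ->
    finite_cut S X ->
    (forall x, X x -> exists h, aV h = x) ->
    (forall w, ~~ X (aV (copy i (blue_ends (w ++ e)).1)) /\
               ~~ X (aV (copy i (blue_ends (w ++ e)).2))) ->
  S (aV (copy i (blue_ends e).1)) = S (aV (copy i (blue_ends e).2)).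
Proof.
move=> si cutS Xim offX; apply/eqP; apply: contrapT => /negP Se.
have /choice[w wP] n : exists w, size w = n /\
    S (aV (copy i (blue_ends (w ++ e)).1)) !=
    S (aV (copy i (blue_ends (w ++ e)).2)).
  elim: n => [|n [w [wn Sw]]]; first by exists [::].
  have [S1 | S1] := boolP (S (aV (copy i (blue_ends (w ++ e)).1)) ==
                     S (aV (copy i (inr (w ++ e))))).
    exists (true :: w); rewrite /= wn; split=> //.
    by rewrite eq_sym -(eqP S1).
  by exists (false :: w); rewrite /= wn.
pose D n : Farey * Farey :=
  (copy i (blue_ends (w n ++ e)).1, copy i (blue_ends (w n ++ e)).2).
apply: (immersion_finite_cut (D := D) si cutS Xim) => [n|n|n|m n].
- exact: Farey_blue.
- exact: offX.
- exact: (wP n).2.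
move=> mn; suff : size (w m ++ e) = size (w n ++ e).
  by rewrite !size_cat (wP m).1 (wP n).1; lia.
rewrite -!born_blue_ends_max.
by case: mn => -[/copy_inj -> /copy_inj ->] //; rewrite maxnC.
Qed.

Lemma Farey_not_in_halved : ~ strongly_immersed Farey halved_Farey.
Proof.
case=> aV [aE si].
have inj : injective aV := si_inj si.
have no_mid i e u :
    (forall w, copy i (blue_ends (w ++ e)).1 <> u /\
               copy i (blue_ends (w ++ e)).2 <> u) ->
    ~ between (pos (aV (copy i (blue_ends e).1)))
              (pos (aV (copy i (blue_ends e).2))) (pos (aV u)).
  move=> off mid.
  have sameS : (pos (aV (copy i (blue_ends e).1)) < pos (aV u))%R =
               (pos (aV (copy i (blue_ends e).2)) < pos (aV u))%R.
    apply: (Farey_finite_cut_ends si (halved_finite_cut (aV u))) => [x|w] /=.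
      by move/eqP ->; exists u.
    by rewrite !(inj_eq inj); case: (off w) => /eqP ? /eqP ?.
  move: mid sameS; rewrite /between.
  by case: (ltgtP (pos (aV (copy i (blue_ends e).1))));
    case: (ltgtP (pos (aV (copy i (blue_ends e).2)))).
(* The edge [[:: b]] joins [inl b] to the apex over the base edge; no edge above it returns to the
   other initial vertex. *)
have off1 b w : (blue_ends (w ++ [:: b])).1 <> inl (~~ b) /\
                (blue_ends (w ++ [:: b])).2 <> inl (~~ b).
  by elim: w => [|c w [IH1 IH2]] /=; [case: b | case: c].
have no_base b : ~ between (pos (aV (inl b))) (pos (aV (inr (true, [::]))))
                    (pos (aV (inl (~~ b)))).
  have := @no_mid true [:: b] (inl (~~ b)); rewrite /=.
  have -> : (if b then inl true else inl false) = inl b :> hvertex by case: b.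
  by apply=> w; have [h1 h2] := off1 b w; split=> /(@copy_inj true _ (inl _)).
(* The edge opposite the apex is the base edge; the edges above it are taken in copy [false], which
   misses the apex. *)
have no_top : ~ between (pos (aV (inl false))) (pos (aV (inl true)))
                    (pos (aV (inr (true, [::])))).
  by apply: (@no_mid false [::]) => w;
    split; case: (blue_ends _) => -[?|?] [?|?].
case: (@between_trichotomy (aV (inl false)) (aV (inl true))
         (aV (inr (true, [::])))); do ?[by move/inj].
- exact: (no_base true).
- exact: (no_base false).
- exact: no_top.
Qed.

Theorem theorem4p1 :
  ~ strongly_immersed K_aleph0 Farey /\
  (~ strongly_immersed K_aleph0 halved_Farey /\
   ~ strongly_immersed Farey halved_Farey).
Proof.
split; first exact: complete_not_in_Farey.
by split; [exact: complete_not_in_halved | exact: Farey_not_in_halved].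
Qed.
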